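(* Let $\mathbf{A}$ be the attractor of the zipper hidden variable iterated function system $\{I\times E;\ \omega_i:\ i=1,\dots,n\}$. Then there exists a continuous map $\mathbf f=(f_1,f_2):I\to\mathbb{R}^2$ which interpolates the data set $P=\{(x_i,y_i,z_i):i=0,\dots,n\}$ and whose graph is $\mathbf A$, i.e. $\mathbf f(x_i)=(y_i,z_i)$ for $i=0,\dots,n$ and $\mathbf A=\{(x,\mathbf f(x)):x\in I\}$.
   Context: Data: $n\ge 2$, real numbers $x_0<x_1<\dots<x_n$, and points $(x_i,y_i,z_i)\in\mathbb{R}^3$, $i=0,\dots,n$ (the $z_i$ are real parameters). A signature $\varepsilon=(\varepsilon_1,\dots,\varepsilon_n)\in\{0,1\}^n$ is given. Put $I=[x_0,x_n]$, $I_i=[x_{i-1},x_i]$ for $i=1,\dots,n$. The map $L_i:I\to I_i$ is the affine map $L_i(x)=a_ix+b_i$ with $L_i(x_0)=x_{i-1+\varepsilon_i}$ and $L_i(x_n)=x_{i-\varepsilon_i}$. Vertical scaling factors: $p_i,q_i,\tilde p_i,\tilde q_i:I_i\to\mathbb{R}$ are Lipschitz functions with $\|p_i\|_\infty+\|\tilde p_i\|_\infty<1$ and $\|q_i\|_\infty+\|\tilde q_i\|_\infty<1$, where $\|\cdot\|_\infty$ is the sup norm. For $x\in I$ let $\mu=\frac{x-x_0}{x_n-x_0}$ and define $r_i(x)=[\mu y_{i-\varepsilon_i}+(1-\mu)y_{i-1+\varepsilon_i}]-p_i(L_i(x))[\mu y_n+(1-\mu)y_0]-q_i(L_i(x))[\mu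 z_n+(1-\mu)z_0]$, $\tilde r_i(x)=[\mu z_{i-\varepsilon_i}+(1-\mu)z_{i-1+\varepsilon_i}]-\tilde p_i(L_i(x))[\mu y_n+(1-\mu)y_0]-\tilde q_i(L_i(x))[\mu z_n+(1-\mu)z_0]$. Define $\mathbf F_i=(F_{i,1},F_{i,2}):I\times\mathbb{R}^2\to\mathbb{R}^2$ by $F_{i,1}(x,y,z)=p_i(L_i(x))y+q_i(L_i(x))z+r_i(x)$, $F_{i,2}(x,y,z)=\tilde p_i(L_i(x))y+\tilde q_i(L_i(x))z+\tilde r_i(x)$. Let $E=[-U,U]\times[-\tilde U,\tilde U]$ where $U=\max_{1\le i\le n}\frac{\|q_i\|_\infty\|\tilde r_i\|_\infty+(1-\|\tilde q_i\|_\infty)\|r_i\|_\infty}{(1-\|p_i\|_\infty)(1-\|\tilde q_i\|_\infty)-\|\tilde p_i\|_\infty\|q_i\|_\infty}$, $\tilde U=\max_{1\le i\le n}\frac{\|\tilde p_i\|_\infty\|r_i\|_\infty+(1-\|p_i\|_\infty)\|\tilde r_i\|_\infty}{(1-\|p_i\|_\infty)(1-\|\tilde q_i\|_\infty)-\|\tilde p_i\|_\infty\|q_i\|_\infty}$. The maps $\omega_i:I\times E\to I_i\times E$ are defined by $\omega_i(x,y,z)=(L_i(x),\mathbf F_i(x,y,z))$, $i=1,\dots,n$. The system $\{I\times E;\omega_i: i=1,\dots,n\}$ is called a zipper hidden variable iterated function system (ZHVIFS). Its attractor $\mathbf A$ is the unique non-empty compact set $\mathbf A\subseteq I\times E$ with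 $\mathbf A=\bigcup_{i=1}^n\omega_i(\mathbf A)$. *)

(* Defs.v *)
From HB Require Import structures.
From mathcomp Require Import all_boot all_order all_algebra.
From mathcomp Require Import all_classical all_reals all_analysis.

Set Implicit Arguments.
Unset Strict Implicit.
Unset Printing Implicit Defensive.

Import Order.TTheory GRing.Theory Num.Theory.
Import numFieldNormedType.Exports.

Local Open Scope classical_set_scope.
Local Open Scope ring_scope.

(* For f bounded on a nonempty A; [sup] is 0 on sets without a supremum. *)
Definition supnorm (R : realType) (A : set R) (f : R -> R) : R :=
  sup [set `|f t| | t in A].

(* The nodes are x_0, ..., x_n, indexed by 'I_n.+1.  The n maps are indexed by
   'I_n, so that [i : 'I_n] stands for the 1-based index i + 1 : its interval
   is [x_i, x_{i+1}].  A signature is boolean, [true] standing for 1. *)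
Definition src_node (n : nat) (eps : 'I_n -> bool) (i : 'I_n) : 'I_n.+1 :=
  inord (i + eps i)%N.

Definition tgt_node (n : nat) (eps : 'I_n -> bool) (i : 'I_n) : 'I_n.+1 :=
  inord (i.+1 - eps i)%N.

Definition whole_itv (R : realType) (n : nat) (x : 'I_n.+1 -> R) : set R :=
  `[x ord0, x ord_max].

Definition sub_itv (R : realType) (n : nat) (x : 'I_n.+1 -> R) (i : 'I_n) :
    set R :=
  `[x (inord i), x (inord i.+1)].

Section ZipperMaps.
Context (R : realType) (n : nat).
Context (x y z : 'I_n.+1 -> R) (eps : 'I_n -> bool).

Definition slope (i : 'I_n) : R :=
  (x (tgt_node eps i) - x (src_node eps i)) / (x ord_max - x ord0).

Definition intercept (i : 'I_n) : R :=
  x (src_node eps i) - slope i * x ord0.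

Definition Lmap (i : 'I_n) (t : R) : R := slope i * t + intercept i.

(* [slope] and [intercept] are the only coefficients with these end values. *)
Lemma Lmap_first (i : 'I_n) : Lmap i (x ord0) = x (src_node eps i).
Proof. by rewrite /Lmap /intercept addrC subrK. Qed.

Lemma Lmap_last (i : 'I_n) :
  x ord0 < x ord_max -> Lmap i (x ord_max) = x (tgt_node eps i).
Proof.
move=> x0n; rewrite /Lmap /intercept addrCA -mulrBr /slope divfK ?subrK.
  by rewrite addrC subrK.
by rewrite subr_eq0 gt_eqF.
Qed.

Definition mu (t : R) : R := (t - x ord0) / (x ord_max - x ord0).

(* [p i], [q i], [p' i], [q' i] are total functions; only their values on
   [sub_itv x i] are ever used below. *)
Context (p q p' q' : 'I_n -> R -> R).

Definition r (i : 'I_n) (t : R) : R :=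
  (mu t * y (tgt_node eps i) + (1 - mu t) * y (src_node eps i))
  - p i (Lmap i t) * (mu t * y ord_max + (1 - mu t) * y ord0)
  - q i (Lmap i t) * (mu t * z ord_max + (1 - mu t) * z ord0).

Definition r' (i : 'I_n) (t : R) : R :=
  (mu t * z (tgt_node eps i) + (1 - mu t) * z (src_node eps i))
  - p' i (Lmap i t) * (mu t * y ord_max + (1 - mu t) * y ord0)
  - q' i (Lmap i t) * (mu t * z ord_max + (1 - mu t) * z ord0).

Definition Fmap (i : 'I_n) (t : R) (v : R * R) : R * R :=
  (p i (Lmap i t) * v.1 + q i (Lmap i t) * v.2 + r i t,
   p' i (Lmap i t) * v.1 + q' i (Lmap i t) * v.2 + r' i t).

Definition bound_den (i : 'I_n) : R :=
  (1 - supnorm (sub_itv x i) (p i)) * (1 - supnorm (sub_itv x i) (q' i))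
  - supnorm (sub_itv x i) (p' i) * supnorm (sub_itv x i) (q i).

(* The base value 0 of the two maxima is harmless: the family is nonempty when
   n > 0, and its members are nonnegative when |p_i| + |p'_i| < 1 and
   |q_i| + |q'_i| < 1 in sup norm. *)
Definition Ubound : R :=
  \big[Num.max/0]_(i < n)
    ((supnorm (sub_itv x i) (q i) * supnorm (whole_itv x) (r' i)
      + (1 - supnorm (sub_itv x i) (q' i)) * supnorm (whole_itv x) (r i))
     / bound_den i).

Definition U'bound : R :=
  \big[Num.max/0]_(i < n)
    ((supnorm (sub_itv x i) (p' i) * supnorm (whole_itv x) (r i)
      + (1 - supnorm (sub_itv x i) (p i)) * supnorm (whole_itv x) (r' i))
     / bound_den i).

Definition Ebox : set (R * R) :=
  `[- Ubound, Ubound]%classic `*` `[- U'bound, U'bound]%classic.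

(* A point (x, y, z) of R^3 is encoded as (x, (y, z)). *)
Definition omega (i : 'I_n) (w : R * (R * R)) : R * (R * R) :=
  (Lmap i w.1, Fmap i w.1 w.2).

Definition invariant_compact (A : set (R * (R * R))) : Prop :=
  [/\ A !=set0, compact A, A `<=` whole_itv x `*` Ebox
    & A = \bigcup_(i in [set: 'I_n]) (omega i @` A)].

Definition is_attractor (A : set (R * (R * R))) : Prop :=
  invariant_compact A /\ forall B, invariant_compact B -> B = A.

End ZipperMaps.

(* Main.v *)
(** The attractor is shown directly to be a graph, without a fixed point in a
    function space.  Its projection to the x-axis is compact and invariant under
    the contractions L_i, whose images cover I, so it is I.  In the l1 norm of
    the (y,z)-plane all the F_i(t, .) contract by a common factor c < 1, because
    the column sums of the matrices (p_i q_i; p'_i q'_i) are uniformly below 1.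
    A point of A above a node comes from a point of A above x_0 or x_n, so the
    largest deviation from the data over the nodes is at most c times itself and
    vanishes.  Two points of A on a common fibre either come from the same
    omega_i, hence from a common fibre, or lie above a node; so the largest
    vertical gap vanishes as well.  A function with compact graph is
    continuous. *)

Require Import Defs.
From HB Require Import structures.
From mathcomp Require Import all_boot all_order all_algebra.
From mathcomp Require Import all_classical all_reals all_analysis.
From mathcomp Require Import zify ring lra.

Set Implicit Arguments.
Unset Strict Implicit.
Unset Printing Implicit Defensive.

Import Order.TTheory GRing.Theory Num.Theory.
Import numFieldNormedType.Exports.

Local Open Scope classical_set_scope.
Local Open Scope ring_scope.

(** * Suprema, compact graphs and sup norms *)

(** From [sup S <= c * sup S] and [c < 1] the supremum is nonpositive. Below, [S] consists of gaps,
    or of lower bounds of gaps. *)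
Lemma contracting_ubound_le0 (R : realType) (S : set R) (c : R) :
    0 <= c < 1 -> has_ubound S ->
    (forall d, S d -> exists2 d', S d' & d <= c * d') ->
  forall d, S d -> d <= 0.
Proof.
move=> /andP[c0 c1] Sub Sc d Sd.
have supc e : S e -> e <= c * sup S.
  move=> /Sc[e' Se' /le_trans]; apply.
  by rewrite ler_wpM2l //; exact: ub_le_sup.
have supS : sup S <= c * sup S by apply: ge_sup => //; exists d.
have := ub_le_sup Sub Sd; nra.
Qed.

Lemma uniform_bound_lt1 (R : realType) (m : nat) (g : 'I_m -> R) :
  (forall i, g i < 1) -> exists2 c, 0 < c < 1 & forall i, g i <= c.
Proof.
(* The base value 1/2 keeps [c] positive, also for [m = 0]; [Lmap_invariant_compact] divides by
   it. *)
move=> g1; exists (\big[Num.max/2^-1]_(i < m) g i); last first.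
  by move=> i; exact: le_bigmax.
apply/andP; split; last by apply: bigmax_lt => //; lra.
by apply: lt_le_trans (bigmax_ge_id _ _ _ _); lra.
Qed.

(** The preimage of a closed set is the projection of a closed part of the compact graph, hence
    compact and closed. *)
Lemma continuous_of_compact_graph (R : realType) (V : normedModType R)
    (D : set R) (f : R -> V) :
  compact [set (t, f t) | t in D] -> {within D, continuous f}.
Proof.
move=> cG; apply/continuous_closedP => C clC; apply/closed_subspaceP.
exists (fst @` ([set (t, f t) | t in D] `&` snd @^-1` C)).
  apply: compact_closed => //; apply: continuous_compact.
    by apply: continuous_subspaceT => -[t v]; exact: cvg_fst.
  apply: compact_closedI => //; apply: closed_comp => // -[t v] _.
  exact: cvg_snd.
apply/seteqP; split => t /=.
  by move=> [[_ [[s Ds <-] /= Cs] <-]].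
by move=> [Ct Dt]; split => //; exists (t, f t) => //; split => //; exists t.
Qed.

Lemma supnorm_ub (R : realType) (a b : R) (f : R -> R) (t : R) :
    [lipschitz f s | s in `[a, b]] -> t \in `[a, b] ->
  `|f t| <= supnorm `[a, b] f.
Proof.
move=> [k [_ flip]] tab; apply: ub_le_sup; last by exists t.
(* The Lipschitz notation grants the estimate only for constants above some [k]; this one is also
   nonnegative. *)
have k1 : k < `|k| + 1 by have := ler_norm k; lra.
exists (`|f t| + (`|k| + 1) * (b - a)) => _ [s /= sab <-].
have fst_le : `|f s - f t| <= (`|k| + 1) * `|s - t| by exact: (flip _ k1 (s, t)).
have sttab : `|s - t| <= b - a.
  by move: sab tab; rewrite !in_itv /= ler_norml; lra.
have -> : f s = f t + (f s - f t) by ring.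
apply: le_trans (ler_normD _ _) _; rewrite lerD2l (le_trans fst_le) //.
by rewrite ler_wpM2l // addr_ge0.
Qed.

(** * Geometry of the nodes and of the maps [L] *)

Section ZipperAttractor.
Context (R : realType) (n : nat) (n_ge2 : (2 <= n)%N).
Context (x y z : 'I_n.+1 -> R).
Context (x_incr : forall i j : 'I_n.+1, (i < j)%N -> x i < x j).
Context (eps : 'I_n -> bool).

Local Notation I := (whole_itv x).
Local Notation src := (src_node eps).
Local Notation tgt := (tgt_node eps).
Local Notation L := (Lmap x eps).

Lemma node_le (i j : 'I_n.+1) : (i <= j)%N -> x i <= x j.
Proof. by rewrite leq_eqVlt => /predU1P[/val_inj ->|/x_incr /ltW]. Qed.

Let x0n : x ord0 < x ord_max.
Proof. by apply: x_incr => /=; lia. Qed.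

Let inord_l (i : 'I_n) : (inord i : 'I_n.+1) = i :> nat.
Proof. by rewrite inordK // ltnS ltnW. Qed.

Let inord_r (i : 'I_n) : (inord i.+1 : 'I_n.+1) = i.+1 :> nat.
Proof. by rewrite inordK // ltnS. Qed.

Let src_tgt (i : 'I_n) :
  [/\ src i = inord i & tgt i = inord i.+1] \/
  [/\ src i = inord i.+1 & tgt i = inord i].
Proof.
rewrite /src_node /tgt_node; case: (eps i); [right|left].
  by rewrite addn1 subn1.
by rewrite addn0 subn0.
Qed.

Let x_sub (i : 'I_n) : x (inord i) < x (inord i.+1).
Proof. by apply: x_incr; rewrite inord_l inord_r. Qed.

Lemma Lmap_mu (i : 'I_n) (t : R) :
  L i t = x (src i) + mu x t * (x (tgt i) - x (src i)).
Proof. by rewrite /Lmap /intercept /slope /mu; field; rewrite subr_eq0 gt_eqF. Qed.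

Let mu01 (t : R) : I t -> 0 <= mu x t <= 1.
Proof.
rewrite /whole_itv /= in_itv /= /mu => /andP[t0 tn].
by rewrite ler_pdivlMr ?ler_pdivrMr ?subr_gt0 // mul0r mul1r; lra.
Qed.

Lemma Lmap_sub (i : 'I_n) (t : R) : I t -> sub_itv x i (L i t).
Proof.
move=> /mu01; rewrite Lmap_mu /sub_itv /= in_itv /=; have := x_sub i.
by case: (src_tgt i) => -[-> ->]; nra.
Qed.

Lemma Lmap_inj (i : 'I_n) : injective (L i).
Proof.
have := x_sub i => xi s t /addIr /mulfI; apply.
rewrite /slope mulf_neq0 ?invr_eq0 ?subr_eq0 ?(gt_eqF x0n) //.
by case: (src_tgt i) => -[-> ->]; rewrite ?(gt_eqF xi) ?(lt_eqF xi).
Qed.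

Lemma Lmap_surj (t : R) : I t -> exists i, exists2 s, I s & L i s = t.
Proof.
rewrite /whole_itv /= in_itv /= => /andP[t0 tn].
have [i ti] : exists i : 'I_n, x (inord i) <= t <= x (inord i.+1).
  have P0 : exists k, (k <= n)%N && (t <= x (inord k)).
    exists n; rewrite leqnn (_ : inord n = ord_max) //.
    by apply: val_inj; rewrite /= inordK.
  (* The least index whose node is at least [t] is the right end of an interval containing [t];
     index 0 means [t = x ord0], which lies in the first interval. *)
  case: (ex_minnP P0) => -[|k] /andP[kn tk] kmin.
    exists (Ordinal (ltnW n_ge2)) => /=.
    have e0 : inord 0 = ord0 :> 'I_n.+1 by apply: val_inj; rewrite /= inordK.
    have := x_sub (Ordinal (ltnW n_ge2)); rewrite /= e0; rewrite e0 in tk.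
    by lra.
  exists (Ordinal kn) => /=; rewrite tk andbT leNgt.
  apply/negP => /ltW tk'; have := kmin k; rewrite tk' (ltnW kn) /= ltnn.
  by move=> /(_ isT).
(* The preimage has the same relative position in [I] as [t] has between the images of the two
   ends. *)
exists i; exists (x ord0 + (t - x (src i)) / (x (tgt i) - x (src i))
                    * (x ord_max - x ord0)); last first.
  rewrite Lmap_mu /mu; have xi := x_sub i.
  case: (src_tgt i) => -[-> ->]; field;
    by rewrite !subr_eq0 (gt_eqF x0n) ?(gt_eqF xi) ?(lt_eqF xi).
rewrite /= in_itv /=.
set m := _ / _; suff : 0 <= m <= 1 by nra.
rewrite /m; have xi := x_sub i; case: (src_tgt i) => -[-> ->].
  by rewrite ler_pdivlMr ?ler_pdivrMr ?subr_gt0 // mul0r mul1r; lra.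
by rewrite ler_ndivlMr ?ler_ndivrMr ?subr_lt0 // mul0r mul1r; lra.
Qed.

(** Two consecutive nodes have no node between them, and both are images of ends of [I]; injectivity
    then identifies [s]. *)
Lemma Lmap_node (i : 'I_n) (s : R) (k : 'I_n.+1) : I s -> L i s = x k ->
  s = x ord0 /\ k = src i \/ s = x ord_max /\ k = tgt i.
Proof.
move=> /(Lmap_sub i) /[swap] Lk; rewrite Lk /sub_itv /= in_itv /= => /andP[ik ki].
have {ik} ik : (i <= k)%N.
  by rewrite leqNgt -[X in (_ < X)%N]inord_l; apply/negP => /x_incr; lra.
have {ki} ki : (k <= i.+1)%N.
  by rewrite leqNgt -[X in (X < _)%N]inord_r; apply/negP => /x_incr; lra.
have [kE|kE] : k = src i \/ k = tgt i.
  have [kE|kE] : (k : nat) = i \/ (k : nat) = i.+1 by lia.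
    have -> : k = inord i by apply: val_inj; rewrite /= inord_l.
    by case: (src_tgt i) => -[-> ->]; [left|right].
  have -> : k = inord i.+1 by apply: val_inj; rewrite /= inord_r.
  by case: (src_tgt i) => -[-> ->]; [right|left].
  by left; split => //; apply: (@Lmap_inj i); rewrite Lk Lmap_first kE.
by right; split => //; apply: (@Lmap_inj i); rewrite Lk Lmap_last ?kE.
Qed.

Lemma Lmap_meet (i j : 'I_n) (s t : R) : I s -> I t -> L i s = L j t ->
  i = j \/ exists k, L i s = x k.
Proof.
wlog ij : i j s t / (i <= j)%N => [wl Is It st|].
  have [ij|ji] := leqP i j; first exact: wl It st.
  have [->|[k Lk]] := wl _ _ _ _ (ltnW ji) It Is (esym st); first by left.
  by right; exists k; rewrite st.
move=> /(Lmap_sub i) /[swap] /(Lmap_sub j); rewrite /sub_itv /= !in_itv /=.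
move=> tj si st; move: ij; rewrite leq_eqVlt => /predU1P[/val_inj ->|ij].
  by left.
(* For [i < j] the common value is at most the right end of interval [i], which is at most the left
   end of interval [j]. *)
right; exists (inord i.+1); apply/eqP.
have : x (inord i.+1) <= x (inord j) by apply: node_le; rewrite inord_r inord_l.
by move: tj; rewrite -st => tj ?; rewrite eq_le; lra.
Qed.

(** As [n >= 2], each subinterval leaves out part of [I]: the first stops before [x ord_max], every
    other starts after [x ord0]. *)
Lemma slope_lt1 (i : 'I_n) : `|slope x eps i| < 1.
Proof.
rewrite /slope normrM normfV (gtr0_norm (x := x ord_max - _)) ?subr_gt0 //.
rewrite ltr_pdivrMr ?subr_gt0 // mul1r.
have -> : `|x (tgt i) - x (src i)| = x (inord i.+1) - x (inord i).
  have xi := x_sub i; case: (src_tgt i) => -[-> ->].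
    by rewrite gtr0_norm ?subr_gt0.
  by rewrite distrC gtr0_norm ?subr_gt0.
have xl : x ord0 <= x (inord i) by exact: node_le.
have xr : x (inord i.+1) <= x ord_max by apply: node_le; rewrite inord_r /=.
have [i0|i0] := posnP i.
  have : x (inord i.+1) < x ord_max by apply: x_incr; rewrite inord_r /= i0.
  by lra.
have : x ord0 < x (inord i) by apply: x_incr; rewrite inord_l.
by lra.
Qed.

(** If [t = L i s], the distance from [t] to [K] is at most [c] times that from [s], because [L i]
    maps [K] into [K]. So all distances vanish, and [K] is closed. *)
Lemma Lmap_invariant_compact (K : set R) :
    K !=set0 -> compact K -> K `<=` I -> (forall i, L i @` K `<=` K) -> K = I.
Proof.
move=> [u0 Ku0] cK KI LK; apply/seteqP; split=> // t It.
have [c /andP[c0 c1] cE] := uniform_bound_lt1 slope_lt1.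
(* Lower bounds of the distance from a point of [I] to [K], so that the
   infimum itself is not needed. *)
pose S := [set d | exists2 t, I t & forall u, K u -> d <= `|t - u|].
have S0 : forall d, S d -> d <= 0.
  apply: (@contracting_ubound_le0 _ _ c); first by lra.
    exists (x ord_max - x ord0) => d [s Is /(_ _ Ku0) /le_trans]; apply.
    have := KI _ Ku0; move: Is; rewrite /whole_itv /= !in_itv /= ler_norml.
    by lra.
  (* Pulling back along [L i] divides a lower bound by at most [c], whence the witness [d / c]. *)
  move=> d [_ /Lmap_surj[i [s Is <-]] dK]; exists (d / c); last first.
    by rewrite mulrCA divff ?mulr1 ?gt_eqF.
  exists s => // u Ku; rewrite ler_pdivrMr // mulrC.
  have := dK (L i u) (LK i _ (imageP _ Ku)).
  have -> : L i s - L i u = slope x eps i * (s - u) by rewrite /Lmap; ring.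
  by rewrite normrM => /le_trans; apply; rewrite ler_wpM2r.
apply: contrapT => Kt.
have : nbhs t (~` K).
  by apply: open_nbhs_nbhs; split => //; rewrite openC; exact: compact_closed.
move=> /nbhs_ballP[e /= e0 eK]; suff /S0 : S e by lra.
exists t => // u Ku; rewrite leNgt; apply/negP => tu.
by apply: (eK u).
Qed.

(** * Contraction of the fibres by [F] *)

Context (p q p' q' : 'I_n -> R -> R).
Context (p_lip : forall i, [lipschitz p i t | t in sub_itv x i]).
Context (q_lip : forall i, [lipschitz q i t | t in sub_itv x i]).
Context (p'_lip : forall i, [lipschitz p' i t | t in sub_itv x i]).
Context (q'_lip : forall i, [lipschitz q' i t | t in sub_itv x i]).

Local Notation F := (Fmap x y z eps p q p' q').

(** The terms subtracted in [r] and [r'] cancel the linear part of [F] on the end data, leaving the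
    data at the source node. *)
Lemma Fmap_first (i : 'I_n) :
  F i (x ord0) (y ord0, z ord0) = (y (src i), z (src i)).
Proof.
have mu0 : mu x (x ord0) = 0 by rewrite /mu subrr mul0r.
by rewrite /Fmap /r /r' mu0 /=; congr pair; ring.
Qed.

Lemma Fmap_last (i : 'I_n) :
  F i (x ord_max) (y ord_max, z ord_max) = (y (tgt i), z (tgt i)).
Proof.
have mu1 : mu x (x ord_max) = 1 by rewrite /mu divff // subr_eq0 gt_eqF.
by rewrite /Fmap /r /r' mu1 /=; congr pair; ring.
Qed.

Definition l1dist (v w : R * R) : R := `|v.1 - w.1| + `|v.2 - w.2|.

Lemma l1dist_le0 (v w : R * R) : l1dist v w <= 0 -> v = w.
Proof.
case: v w => [v1 v2] [w1 w2]; rewrite /l1dist /= => vw.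
have h1 := normr_ge0 (v1 - w1); have h2 := normr_ge0 (v2 - w2).
by congr pair; apply/eqP; rewrite -subr_eq0 -normr_eq0 eq_le; lra.
Qed.

Lemma l1dist_le (v w : R * R) :
  l1dist v w <= (`|v.1| + `|v.2|) + (`|w.1| + `|w.2|).
Proof. by rewrite addrACA lerD // ler_normB. Qed.

(** The terms [r], [r'] cancel in differences; collecting the coefficients of each coordinate gives
    the column sums. *)
Lemma Fmap_contract (i : 'I_n) (c : R) (t : R) (v w : R * R) :
    supnorm (sub_itv x i) (p i) + supnorm (sub_itv x i) (p' i) <= c ->
    supnorm (sub_itv x i) (q i) + supnorm (sub_itv x i) (q' i) <= c ->
    I t ->
  l1dist (F i t v) (F i t w) <= c * l1dist v w.
Proof.
move=> pc qc /(Lmap_sub i) Lt; rewrite /l1dist /=.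
have := supnorm_ub (p_lip i) Lt; have := supnorm_ub (q_lip i) Lt.
have := supnorm_ub (p'_lip i) Lt; have := supnorm_ub (q'_lip i) Lt.
rewrite -!/(sub_itv x i).
set P := p _ _; set Q := q _ _; set P' := p' _ _; set Q' := q' _ _.
move=> hQ' hP' hQ hP.
rewrite [X in `|X| + _ <= _](_ : _ = P * (v.1 - w.1) + Q * (v.2 - w.2));
  last by ring.
rewrite [X in _ + `|X| <= _](_ : _ = P' * (v.1 - w.1) + Q' * (v.2 - w.2));
  last by ring.
apply: le_trans (lerD (ler_normD _ _) (ler_normD _ _)) _.
rewrite !normrM.
have := normr_ge0 (v.1 - w.1); have := normr_ge0 (v.2 - w.2); nra.
Qed.

Context (p_lt1 : forall i,
  supnorm (sub_itv x i) (p i) + supnorm (sub_itv x i) (p' i) < 1).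
Context (q_lt1 : forall i,
  supnorm (sub_itv x i) (q i) + supnorm (sub_itv x i) (q' i) < 1).

Lemma Fmap_contract_uniform : exists2 c, 0 < c < 1 &
  forall i t v w, I t -> l1dist (F i t v) (F i t w) <= c * l1dist v w.
Proof.
have [c c01 cE] := @uniform_bound_lt1 R n (fun i =>
  Num.max (supnorm (sub_itv x i) (p i) + supnorm (sub_itv x i) (p' i))
          (supnorm (sub_itv x i) (q i) + supnorm (sub_itv x i) (q' i)))
  (fun i => ltac:(by rewrite gt_max p_lt1 q_lt1)).
exists c => // i t v w It; have := cE i; rewrite ge_max => /andP[pc qc].
exact: Fmap_contract.
Qed.

(** * Fibres of the attractor *)

Context (A : set (R * (R * R))).
Context (A_inv : invariant_compact x y z eps p q p' q' A).

Let A_itv (t : R) (v : R * R) : A (t, v) -> I t.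
Proof. by case: A_inv => _ _ AE _ /AE[]. Qed.

Let A_box (t : R) (v : R * R) : A (t, v) ->
  `|v.1| + `|v.2| <= Ubound x y z eps p q p' q' + U'bound x y z eps p q p' q'.
Proof.
case: A_inv => _ _ AE _ /AE[_ []] /=; rewrite !in_itv /= -!ler_norml.
exact: lerD.
Qed.

Let A_pre (t : R) (v : R * R) : A (t, v) ->
  exists i s u, [/\ A (s, u), L i s = t & F i s u = v].
Proof.
case: A_inv => _ _ _ AE; rewrite {1}AE => -[i _ [[s u] Asu [st uv]]].
by exists i, s, u.
Qed.

(** The first projection intertwines [omega i] with [L i], so it carries compactness and invariance
    over to [I]. *)
Lemma attractor_fst : fst @` A = I.
Proof.
case: A_inv => -[[t0 v0] A0] cA _ AE.
apply: Lmap_invariant_compact; first by exists t0, (t0, v0).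
- apply: continuous_compact => //.
  by apply: continuous_subspaceT => -[t v]; exact: cvg_fst.
- by move=> _ [[t v] /A_itv It <-].
- move=> i _ [_ [[t v] Atv <-] <-].
  exists (omega x y z eps p q p' q' i (t, v)) => //.
  by rewrite AE; exists i => //; exists (t, v).
Qed.

Lemma attractor_node (k : 'I_n.+1) (v : R * R) :
  A (x k, v) -> v = (y k, z k).
Proof.
have [c /andP[c0 c1] cF] := Fmap_contract_uniform.
pose S := [set d | exists l u, A (x l, u) /\ d = l1dist u (y l, z l)].
have S0 : forall d, S d -> d <= 0.
  apply: (@contracting_ubound_le0 _ _ c); first by lra.
    exists ((Ubound x y z eps p q p' q' + U'bound x y z eps p q p' q')
            + \big[Num.max/0]_l (`|y l| + `|z l|)).
    move=> _ [l [u [/A_box Au ->]]].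
    apply: le_trans (l1dist_le _ _) _; rewrite lerD //.
    exact: (le_bigmax _ (fun l => `|y l| + `|z l|)).
  move=> _ [l [u [/A_pre[i [s [u' [Asu' /Lmap_node nodes <-]]]] ->]]].
  (* The datum at [x l] is the [F i]-image of the datum at the end of [I] that [L i] sends there, so
     contraction compares the two deviations. *)
  have Is := A_itv Asu'; have [[sE ->]|[sE ->]] := nodes Is.
    exists (l1dist u' (y ord0, z ord0)); first by exists ord0, u'; rewrite -sE.
    by rewrite -Fmap_first -sE; exact: cF.
  exists (l1dist u' (y ord_max, z ord_max)).
    by exists ord_max, u'; rewrite -sE.
  by rewrite -Fmap_last -sE; exact: cF.
by move=> Akv; apply/l1dist_le0/S0; exists k, v.
Qed.

Lemma attractor_functional (t : R) (v w : R * R) :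
  A (t, v) -> A (t, w) -> v = w.
Proof.
have [c /andP[c0 c1] cF] := Fmap_contract_uniform.
pose S := [set d | exists s u u', [/\ A (s, u), A (s, u') & d = l1dist u u']].
have S0 : forall d, S d -> d <= 0.
  apply: (@contracting_ubound_le0 _ _ c); first by lra.
    exists ((Ubound x y z eps p q p' q' + U'bound x y z eps p q p' q') *+ 2).
    move=> _ [s [u [u' [/A_box Au /A_box Au' ->]]]].
    by apply: le_trans (l1dist_le _ _) _; rewrite mulr2n lerD.
  move=> _ [s [u [u' [Au Au' ->]]]].
  have [i [a [b [Aab La Fb]]]] := A_pre Au.
  have [j [a' [b' [Aab' La' Fb']]]] := A_pre Au'.
  have Ia := A_itv Aab; have Ia' := A_itv Aab'.
  have [ij|[k sk]] := Lmap_meet Ia Ia' (etrans La (esym La')).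
    subst j; have aa' : a' = a by apply: (@Lmap_inj i); rewrite La La'.
    subst a'; exists (l1dist b b'); first by exists a, b, b'.
    by rewrite -Fb -Fb'; exact: cF.
  rewrite -La sk in Au Au'.
  rewrite (attractor_node Au) (attractor_node Au').
  (* At a common node both values are the datum; the gap 0 belongs to [S] as that of a point with
     itself. *)
  exists 0; last by rewrite /l1dist !subrr !normr0 addr0 mulr0.
  by exists (x k), u, u; rewrite /l1dist !subrr !normr0 addr0.
by move=> Av Aw; apply/l1dist_le0/S0; exists t, v, w.
Qed.

End ZipperAttractor.

(** * The interpolating function *)

Theorem theorem2 (R : realType) (n : nat) (n_ge2 : (2 <= n)%N)
    (x y z : 'I_n.+1 -> R)
    (x_incr : forall i j : 'I_n.+1, (i < j)%N -> x i < x j)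
    (eps : 'I_n -> bool)
    (p q p' q' : 'I_n -> R -> R)
    (p_lip : forall i, [lipschitz p i t | t in sub_itv x i])
    (q_lip : forall i, [lipschitz q i t | t in sub_itv x i])
    (p'_lip : forall i, [lipschitz p' i t | t in sub_itv x i])
    (q'_lip : forall i, [lipschitz q' i t | t in sub_itv x i])
    (p_lt1 : forall i,
      supnorm (sub_itv x i) (p i) + supnorm (sub_itv x i) (p' i) < 1)
    (q_lt1 : forall i,
      supnorm (sub_itv x i) (q i) + supnorm (sub_itv x i) (q' i) < 1)
    (A : set (R * (R * R)))
    (A_attractor : is_attractor x y z eps p q p' q' A) :
  exists f : R -> R * R,
    [/\ {within whole_itv x, continuous f},
        forall i : 'I_n.+1, f (x i) = (y i, z i)
      & A = [set (t, f t) | t in whole_itv x]].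
Proof.
have [A_inv _] := A_attractor.
(* [get] picks a point of the fibre, nonempty over [I] because [A] projects onto [I]; elsewhere it
   returns a default. *)
have fA t : whole_itv x t -> A (t, get [set v | A (t, v)]).
  rewrite -(attractor_fst n_ge2 x_incr A_inv) => -[[s v] Asv /= <-].
  by apply: (@getPex _ [set u | A (s, u)]); exists v.
have AE : A = [set (t, get [set v | A (t, v)]) | t in whole_itv x].
  apply/seteqP; split => [[t v] Atv|_ [t It <-]]; last exact: fA.
  have It : whole_itv x t.
    by rewrite -(attractor_fst n_ge2 x_incr A_inv); exists (t, v).
  exists t => //; congr pair.
  exact: (attractor_functional n_ge2 x_incr p_lip q_lip p'_lip q'_lip
            p_lt1 q_lt1 A_inv (fA t It) Atv).
exists (fun t => get [set v | A (t, v)]); split => // [|i].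
  by apply: continuous_of_compact_graph; rewrite -AE; case: A_inv.
apply: (attractor_node n_ge2 x_incr p_lip q_lip p'_lip q'_lip p_lt1 q_lt1 A_inv).
apply: fA; rewrite /whole_itv /= in_itv /=.
by rewrite !(node_le x_incr) //= -ltnS.
Qed.
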